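(* Let $k$ be a positive integer and let $G$ be a graph that contains none of $K_{1,k}$, $kK_2$ (a matching with $k$ edges) and $2K_{1,k-1}$ (two vertex-disjoint copies of $K_{1,k-1}$) as a subgraph. Then $$e(G)\le g_1(k)=\begin{cases}k^2-\frac32k+\frac12 & k \text{ odd},\\ k^2-\frac32 k & k \text{ even}.\end{cases}$$ Furthermore, up to adding or deleting isolated vertices, equality holds if and only if $G=R(2k-1,k-1)$ when $k$ is odd, and $G=R(2k-1,k-1)$ or $G=R(k+1,k-1)\cup K_{k-1}$ when $k$ is even.
   Context: $e(G)$ is the number of edges of $G$. $R(n,d)$ denotes an almost $d$-regular graph on $n$ vertices, i.e. a graph on $n$ vertices in which all vertices have degree $d$ except at most one vertex of degree $d-1$. $G_1\cup G_2$ denotes disjoint union. *)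

(* Defs.v *)
From mathcomp Require Import all_boot.
Unset Printing Implicit Defensive.

Definition simple_graph {T : finType} (e : rel T) : Prop :=
  symmetric e /\ irreflexive e.

Definition nedges {T : finType} (e : rel T) : nat :=
  #|[set [set x; y] | x in T, y in T & e x y]|.

Definition deg {T : finType} (e : rel T) (x : T) : nat := #|[set y | e x y]|.

Definition contains {V T : finType} (h : rel V) (e : rel T) : Prop :=
  exists f : V -> T, injective f /\ forall x y, h x y -> e (f x) (f y).

Definition star_graph (k : nat) : rel 'I_k.+1 :=
  fun x y => (x == ord0) != (y == ord0).

Definition matching_graph (k : nat) : rel ('I_k * bool)%type :=
  fun x y => (x.1 == y.1) && (x.2 != y.2).

Definition two_stars_graph (k : nat) : rel (bool * 'I_k.-1.+1)%type :=
  fun x y => (x.1 == y.1) && ((x.2 == ord0) != (y.2 == ord0)).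

Definition almost_regular {U : finType} (e : rel U) (d : nat) : Prop :=
  (forall x, deg e x = d \/ deg e x = d.-1) /\ #|[set x | deg e x != d]| <= 1.

Definition non_isolated {T : finType} (e : rel T) : {set T} :=
  [set x | [exists y, e x y]].

Definition iso_upto_isolated {T U : finType} (e : rel T) (h : rel U) : Prop :=
  exists f : T -> U,
    {in non_isolated e &, injective f} /\
    (forall x y, x \in non_isolated e -> y \in non_isolated e ->
       h (f x) (f y) = e x y) /\
    f @: non_isolated e = non_isolated h.

Definition union_with_clique {m : nat} (n : nat) (r : rel 'I_m) : rel ('I_m + 'I_n)%type :=
  fun x y => match x, y with
             | inl a, inl b => r a b
             | inr a, inr b => a != b
             | _, _ => false
             end.

(* g_1(k) = k^2 - 3k/2 + 1/2 (k odd), k^2 - 3k/2 (k even); exact divisions *)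
Definition g1 (k : nat) : nat :=
  if odd k then ((k - 1) * (2 * k - 1)) %/ 2 else (k * (2 * k - 3)) %/ 2.

(* Main.v *)
Require Import Defs.
From mathcomp Require Import all_boot zify.

(** Put [d = k - 1]. By the Berge-Tutte formula there are a set [S] and a
    partition of the other vertices into blocks with no edge between two blocks,
    such that [#|S| + \sum_C #|C|./2 <= d]. The edges meeting [S] number at most
    [d * #|S|], and a block [C] spans at most [d * #|C|./2] edges, except that an
    odd block with more than [d] vertices may span [d./2] more. Two such
    exceptional blocks force [S] to be empty and both blocks to have [d + 1]
    vertices; as two vertices of degree [d] have intersecting closed
    neighbourhoods, one of the blocks then has all its degrees below [d], and the
    bound is strict. Otherwise the bound is [d ^ 2 + d./2], which is [g1 k]. In
    the case of equality the exceptional block [C] is almost [d]-regular; a vertex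
    of [S] would have degree [d] and could meet the neighbourhoods of the vertices
    of [C] only through the deficient vertex of [C], which would have to be
    adjacent to all of [C]. Hence [S] is empty, and the blocks other than [C] are
    single vertices or one clique on [d] vertices. *)

Set Implicit Arguments.
Unset Strict Implicit.

(** * Fixed-point-free involutions *)

Section Involution.
Variables (T : finType) (f : T -> T) (A : {set T}).
Hypothesis fA : {in A, forall x, f x \in A}.
Hypothesis ffK : {in A, forall x, f (f x) = x}.
Hypothesis fN : {in A, forall x, f x != x}.

(** Each orbit [{x, f x}] has two elements; keeping the one of smaller [enum_rank] chooses one per
    orbit. *)
Lemma involution_transversal :
  exists B : {set T}, A = B :|: f @: B /\ [disjoint B & f @: B].
Proof.
exists [set x in A | enum_rank x < enum_rank (f x)]; split.
  apply/setP=> x; rewrite !inE; apply/idP/orP => [xA | [/andP[]// |]]; last first.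
    by case/imsetP=> y; rewrite inE => /andP[yA _] ->; apply: fA.
  rewrite xA /=; case: ltngtP => [|lt|/val_inj/enum_rank_inj eq]; [by left| |].
    by right; apply/imsetP; exists (f x); rewrite ?ffK // inE fA // ffK.
  by have:= fN xA; rewrite -eq eqxx.
rewrite disjoints_subset; apply/subsetP=> x; rewrite !inE => /andP[xA lt].
apply/imsetP=> -[y]; rewrite inE => /andP[yA lt'] eq.
by move: lt; rewrite eq ffK // ltnNge (ltnW lt').
Qed.

Lemma card_involution_transversal (B : {set T}) :
  A = B :|: f @: B -> [disjoint B & f @: B] -> #|A| = #|B|.*2.
Proof.
move=> eqA dis; have sBA : B \subset A by rewrite eqA subsetUl.
rewrite {1}eqA cardsU disjoint_setI0 // cards0 subn0 card_in_imset ?addnn //.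
by move=> x y xB yB /(congr1 f); rewrite !ffK ?(subsetP sBA).
Qed.

Lemma even_involution : ~~ odd #|A|.
Proof.
have [B [eqA dis]] := involution_transversal.
by rewrite (card_involution_transversal eqA dis) odd_double.
Qed.

End Involution.

(** * Matchings as involutions *)

Section Matching.
Variables (T : finType) (e : rel T).
Hypotheses (sym : symmetric e) (irr : irreflexive e).
Implicit Types (W : {set T}) (f g : {ffun T -> T}).

(* A matching of the subgraph induced by [W] is the involution exchanging the
   ends of its edges, so that its fixed points are the unmatched vertices. *)
Definition matching W f :=
  [forall x, (f (f x) == x) && ((f x != x) ==> (x \in W) && e x (f x))].

Definition covered f := [set x | f x != x].

Definition max_matching W f :=
  matching W f && [forall g, matching W g ==> (#|covered g| <= #|covered f|)].

Lemma matchingP W f :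
  reflect ((forall x, f (f x) = x) /\
           (forall x, f x != x -> x \in W /\ e x (f x)))
          (matching W f).
Proof.
apply: (iffP forallP) => [H | [H1 H2] x].
  split=> x; have /andP[/eqP // _ /implyP H2] := H x.
  by move/H2/andP.
by rewrite H1 eqxx; apply/implyP=> /H2 [-> ->].
Qed.

Lemma even_covered W f : matching W f -> ~~ odd #|covered f|.
Proof.
case/matchingP=> fK _.
apply: (@even_involution _ f) => x; rewrite !inE ?fK //; first by rewrite eq_sym.
Qed.

Lemma max_matching_exists W : exists f, max_matching W f.
Proof.
have id_m : matching W [ffun x => x].
  by apply/matchingP; split=> x; rewrite !ffunE ?eqxx.
case: (arg_maxnP (fun f => #|covered f|) id_m) => f fm fmax.
by exists f; rewrite /max_matching fm; apply/forallP=> g; apply/implyP/fmax.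
Qed.

Lemma max_matchingP W f g :
  max_matching W f -> matching W g -> #|covered g| <= #|covered f|.
Proof. by case/andP=> _ /forallP/(_ g)/implyP. Qed.

(* Match the vertex [x] with [y], dropping the edge of [f] at [y]. *)
Definition rematch f x y : {ffun T -> T} :=
  [ffun w => if w == x then y else if w == y then x
             else if w == f y then w else f w].

Lemma rematch_matching W f x y :
  matching W f -> f x = x -> x \in W -> y \in W -> e x y ->
  matching W (rematch f x y).
Proof.
case/matchingP=> fK fe fx xW yW exy.
have xy : x != y by apply/eqP=> eq; rewrite eq irr in exy.
have eyx : e y x by rewrite sym.
have fyx : f y != x by apply: contra_neq xy => eq; rewrite -fx -eq fK.
apply/matchingP; split=> w; rewrite !ffunE.
  have [->|wx] := eqVneq w x; first by rewrite (negbTE (contra_neq _ xy)) // eqxx.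
  have [->|wy] := eqVneq w y; first by rewrite eqxx.
  have [eqw|wf] := eqVneq w (f y); first by rewrite (negbTE wx) (negbTE wy) eqw eqxx.
  rewrite fK; have [eq|_] := eqVneq (f w) x; first by rewrite -(fK w) eq fx eqxx in wx.
  have [eq|_] := eqVneq (f w) y; first by rewrite -eq fK eqxx in wf.
  have [eq|_] := eqVneq (f w) (f y) => //.
  by rewrite -(fK w) eq fK eqxx in wy.
have [->|wx] := eqVneq w x; first by [].
have [->|wy] := eqVneq w y; first by [].
have [->|wf] := eqVneq w (f y); first by rewrite eqxx.
exact: fe.
Qed.

Lemma covered_rematch_free f x y :
  f x = x -> f y = y -> x != y ->
  #|covered f| < #|covered (rematch f x y)|.
Proof.
move=> fx fy xy; apply/proper_card/properP; split.
  apply/subsetP=> w; rewrite !inE !ffunE fy => fw.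
  have [eq|wx] := eqVneq w x; first by rewrite eq fx eqxx in fw.
  by have [eq|wy] := eqVneq w y; first by rewrite eq fy eqxx in fw.
by exists x; rewrite !inE ?ffunE ?fx eqxx // eq_sym.
Qed.

(** The new edge covers [x] and releases [f y], the former partner of [y]. *)
Lemma covered_rematch W f x y :
  matching W f -> f x = x -> f y != y -> x != y ->
  #|covered (rematch f x y)| = #|covered f|.
Proof.
case/matchingP=> fK _ fx fy xy.
have fyx : f y != x by apply: contra_neq xy => eq; rewrite -fx -eq fK.
have eqx : covered (rematch f x y) :\ x = covered f :\ f y.
  apply/setP=> w; rewrite !inE !ffunE.
  have [->|wx] := eqVneq w x; first by rewrite fx eqxx andbF.
  have [->|wy] := eqVneq w y; first by rewrite xy eq_sym fy.
  by have [->|wf] := eqVneq w (f y); rewrite ?eqxx.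
rewrite (cardsD1 x) (cardsD1 (f y) (covered f)) eqx !inE !ffunE eqxx fK.
by rewrite [y == x]eq_sym xy [y == f y]eq_sym fy.
Qed.

(** Gallai's relation: no maximum matching misses both vertices. The disjunct [u == v] makes it
    reflexive. *)
Definition same_block W u v :=
  (u == v) || [forall f, max_matching W f ==> (f u != u) || (f v != v)].

Lemma same_blockP W u v f :
  same_block W u v -> max_matching W f -> f u = u -> f v = v -> u = v.
Proof.
case/orP=> [/eqP//|/forallP/(_ f)/implyP H] /H; case/orP=> /eqP H' H1 H2.
  by case: H'.
by case: H'.
Qed.

Lemma same_block_sym W u v : same_block W u v = same_block W v u.
Proof.
by rewrite /same_block eq_sym; congr orb; apply: eq_forallb => f; rewrite orbC.
Qed.

Lemma same_block_edge W u v :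
  u \in W -> v \in W -> e u v -> same_block W u v.
Proof.
move=> uW vW euv; apply/orP; right; apply/forallP=> f; apply/implyP=> fm.
rewrite -negb_and; apply/negP=> /andP[/eqP fu /eqP fv].
have uv : u != v by apply/eqP=> eq; rewrite eq irr in euv.
have [m _] := andP fm.
have := max_matchingP fm (rematch_matching m fu uW vW euv).
by rewrite leqNgt (covered_rematch_free fu fv uv).
Qed.

(* Gallai's lemma. If a maximum matching [M] missed both [u] and [v], take a
   maximum matching [N] missing [t] that shares as many edges as possible with
   [M]; it covers [u] and [v], so [M] covers some [x <> t] missed by [N], and
   switching [N] to the [M]-edge at [x] increases the agreement. *)
Lemma same_block_trans W u t v :
  (exists2 f, max_matching W f & f t = t) ->
  same_block W u t -> same_block W t v -> same_block W u v.
Proof.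
case=> N0 N0max N0t ut tv; have [//|neq_uv] := boolP (u == v).
  by rewrite /same_block => ->.
apply/orP; right; apply/forallP=> M; apply/implyP=> Mmax.
rewrite -negb_and; apply/negP=> /andP[/eqP Mu /eqP Mv].
have neq_tu : t != u by apply/eqP=> eq; rewrite -eq in Mu neq_uv;
   rewrite (same_blockP tv Mmax Mu Mv) eqxx in neq_uv.
have neq_tv : t != v by apply/eqP=> eq; rewrite -eq in Mv neq_uv;
   rewrite (same_blockP ut Mmax Mu Mv) eqxx in neq_uv.
have Mt : M t != t by apply: contra_neq neq_tu => Mt; rewrite (same_blockP ut Mmax Mu Mt).
pose agree N := [set w | (M w != w) && (M w == N w)].
have N0P : max_matching W N0 && (N0 t == t) by rewrite N0max N0t eqxx.
case: (@arg_maxnP _ N0 (fun N => max_matching W N && (N t == t)) (fun N => #|agree N|) N0P).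
move=> N /andP[Nmax /eqP Nt] Nagree.
have Nu : N u != u by apply: contra_neq neq_tu => Nu; rewrite (same_blockP ut Nmax Nu Nt).
have Nv : N v != v by apply: contra_neq neq_tv => Nv; rewrite (same_blockP tv Nmax Nt Nv).
have [[Mm _] [Nm _]] := (andP Mmax, andP Nmax).
have eqMN : #|covered M| = #|covered N|.
  by apply/eqP; rewrite eqn_leq (max_matchingP Nmax Mm) (max_matchingP Mmax Nm).
have ltD : 1 < #|covered M :\: covered N|.
  have -> : #|covered M :\: covered N| = #|covered N :\: covered M|.
    by rewrite !cardsD eqMN setIC.
  have <- : #|[set u; v]| = 2 by rewrite cards2 neq_uv.
  apply/subset_leq_card/subsetP=> w; rewrite !inE => /orP[] /eqP ->.
    by rewrite Mu eqxx.
  by rewrite Mv eqxx.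
have [x] : exists x, x \in (covered M :\: covered N) :\ t.
  apply/set0Pn; rewrite -card_gt0.
  by move: ltD; rewrite (cardsD1 t); case: (_ \in _) => //; lia.
rewrite !inE negbK => /and3P[xt /eqP Nx Mx].
have /matchingP[MK Me] := Mm; have /matchingP[NK Ne] := Nm.
set y := M x.
have [xW exy] := Me _ Mx.
have [yW _] : M x \in W /\ e (M x) (M (M x)) by apply: Me; rewrite MK eq_sym.
have xy : x != y by rewrite eq_sym.
have Ny : N y != y.
  apply/eqP=> Ny; have := max_matchingP Nmax (rematch_matching Nm Nx xW yW exy).
  by rewrite leqNgt (covered_rematch_free Nx Ny xy).
have yt : y != t by apply: contra_neq Ny => ->.
have R := rematch_matching Nm Nx xW yW exy.
have Rmax : max_matching W (rematch N x y).
  rewrite /max_matching R; apply/forallP=> g; apply/implyP=> gm.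
  by rewrite (covered_rematch Nm Nx Ny xy); apply: max_matchingP gm.
have Rt : rematch N x y t = t.
  rewrite ffunE eq_sym (negbTE xt) eq_sym (negbTE yt) Nt.
  by case: ifP.
have := Nagree (rematch N x y); rewrite Rmax Rt eqxx => /(_ isT).
(* The switch gains agreement at [x]; the dropped [N]-edge at [y] was not in [M], since [M y = x]
   while [N y != x]. *)
apply/negP; rewrite -ltnNge; apply/proper_card/properP; split.
  apply/subsetP=> w; rewrite !inE !ffunE => /andP[-> /eqP MN] /=.
  have [->|wx] := eqVneq w x; first by [].
  have [->|wy] := eqVneq w y; first by rewrite /y MK.
  have [eq|wf] := eqVneq w (N y); last by rewrite MN.
  rewrite eq NK in MN; rewrite -eq in MN.
  by rewrite -(MK w) MN /y MK eqxx in wx.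
by exists x; rewrite !inE ?ffunE ?eqxx ?Nx ?Mx // (negbTE Mx) andbF.
Qed.

(* A vertex covered by every maximum matching is moved to [S]; once there is none
   left, [same_block] is an equivalence and each of its classes contains at most
   one vertex missed by a given maximum matching. *)
Lemma berge_tutte_in W :
  exists (S : {set T}) (P : {set {set T}}),
    [/\ S \subset W, partition P (W :\: S),
        {in W :\: S &, forall x y, e x y -> pblock P x = pblock P y} &
        forall f, max_matching W f ->
          (#|S| + \sum_(C in P) #|C|./2).*2 <= #|covered f| ].
Proof.
have [n] := ubnP #|W|; elim: n W => // n IHn W leWn.
have [|noS] := boolP [exists v in W, [forall f, max_matching W f ==> (f v != v)]].
  case/exists_inP=> v vW /forallP vcov.
  have [|S [P [SW parP edgeP leP]]] := IHn (W :\ v).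
    by move: leWn; rewrite (cardsD1 v) vW.
  have eqW : W :\: (v |: S) = (W :\ v) :\: S by rewrite setDDl.
  have vS : v \notin S by apply/negP=> /(subsetP SW); rewrite !inE eqxx.
  exists (v |: S), P; split; rewrite ?eqW //.
    rewrite subUset sub1set vW; apply: subset_trans SW _; exact: subsetDl.
  move=> f fmax; have [g gmax] := max_matching_exists (W :\ v).
  have [gm _] := andP gmax; have /matchingP[gK ge] := gm.
  have gmW : matching W g.
    apply/matchingP; split=> // x /ge [] /[!inE] /andP[_ ->] //.
  have gv : g v = v by apply/eqP/negPn/negP=> /ge []; rewrite !inE eqxx.
  have lt : #|covered g| < #|covered f|.
    rewrite ltn_neqAle (max_matchingP fmax gmW) andbT; apply/eqP=> eq.
    have: max_matching W g.
      rewrite /max_matching gmW; apply/forallP=> h; apply/implyP=> hm.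
      by rewrite eq (max_matchingP fmax).
    by move: (vcov g) => /implyP H /H; rewrite gv eqxx.
  have [fm _] := andP fmax.
  (* Both cardinals are even, so the strict inequality is a gap of at least two, which pays for
     adding [v] to [S]. *)
  have := even_covered gm; have := even_covered fm; have := leP _ gmax.
  rewrite cardsU1 vS; lia.
have miss v : v \in W -> exists2 f, max_matching W f & f v = v.
  move=> vW; move: noS; rewrite negb_exists_in => /forall_inP/(_ v vW).
  by rewrite negb_forall => /existsP[f]; rewrite negb_imply negbK => /andP[? /eqP]; exists f.
have eqv : {in W & &, equivalence_rel (same_block W)}.
  move=> x y z xW yW zW; split; first by rewrite /same_block eqxx.
  move=> xy; apply/idP/idP; apply: same_block_trans => //; try exact: miss.
  by rewrite same_block_sym.
pose P := equivalence_partition (same_block W) W.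
have parP : partition P W := equivalence_partitionP eqv.
exists set0, P; split; rewrite ?sub0set ?setD0 //.
  move=> x y xW yW exy; apply/esym/eqP.
  rewrite eq_pblock ?(cover_partition parP) //; last by case/and3P: parP.
  by rewrite pblock_equivalence_partition // same_block_sym same_block_edge.
move=> f fmax; have [fm _] := andP fmax; have /matchingP[fK fe] := fm.
have fW x : f x != x -> x \in W by move/fe=> [].
have -> : #|covered f| = \sum_(C in P) #|covered f :&: C|.
  have -> : #|covered f| = \sum_(x in W) (f x != x).
    rewrite -sum1_card (bigID (mem W)) /= [X in _ + X]big1 ?addn0; last first.
      by move=> x; rewrite inE => /andP[/fW ->].
    by rewrite big_mkcondl; apply: eq_big => // x; rewrite !inE; case: (x \in W); case: (f x != x).
  rewrite (set_partition_big _ parP) /=; apply: eq_bigr => C _.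
  rewrite -sum1_card big_mkcond [RHS]big_mkcond /=; apply: eq_bigr => x _.
  by rewrite !inE; case: (x \in C); case: (f x != x).
rewrite cards0 add0n -[in X in X <= _]muln2 big_distrl /=; apply: leq_sum => C CP.
have sCW : C \subset W by rewrite -(cover_partition parP) bigcup_sup.
have blockC x y : x \in C -> y \in C -> same_block W x y.
  move=> xC yC; have tP : trivIset P by case/and3P: parP.
  rewrite -(pblock_equivalence_partition eqv) ?(subsetP sCW) //.
  by rewrite -/P (def_pblock tP CP xC).
(* Matched vertices are adjacent, hence in the same block, so [f] preserves the covered part of [C],
   which is therefore even. With at most one missed vertex it has at least [(#|C|./2).*2]
   elements. *)
have ev : ~~ odd #|covered f :&: C|.
  apply: (@even_involution _ f) => x /[!inE] /andP[fx xC]; rewrite ?fK //.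
  have [xW exf] := fe _ fx.
  have [fxW _] : f x \in W /\ e (f x) (f (f x)) by apply: fe; rewrite fK eq_sym.
  rewrite eq_sym fx /=; have tP : trivIset P by case/and3P: parP.
  rewrite -(def_pblock tP CP xC) pblock_equivalence_partition //.
  exact: same_block_edge.
have le1 : #|C :\: covered f| <= 1.
  apply/card_le1_eqP=> x y /[!inE] /[!negbK] /andP[/eqP fx xC] /andP[/eqP fy yC].
  exact: (same_blockP (blockC _ _ yC xC) fmax).
have := cardsID (covered f) C; rewrite setIC; lia.
Qed.

End Matching.

(** * Forbidden subgraphs *)

Section Forbidden.
Variables (T : finType) (e : rel T).
Hypotheses (sym : symmetric e) (irr : irreflexive e).

Definition nbhd x := [set y | e x y].

(** The centre sits at position 0, like [ord0] in the star graphs, so that positions give the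
    embedding. *)
Definition star_seq x := x :: enum (nbhd x).

Lemma star_seq_uniq x : uniq (star_seq x).
Proof. by rewrite /= mem_enum inE irr enum_uniq. Qed.

Lemma size_star_seq x : size (star_seq x) = (deg e x).+1.
Proof. by rewrite /= -cardE. Qed.

Lemma mem_star_seq x : star_seq x =i x |: nbhd x.
Proof. by move=> y; rewrite !inE mem_enum inE. Qed.

Lemma star_seq_edge x z i j :
  i <= deg e x -> j <= deg e x -> (i == 0) != (j == 0) ->
  e (nth z (star_seq x) i) (nth z (star_seq x) j).
Proof.
have leaf n : n < deg e x -> e x (nth z (enum (nbhd x)) n).
  move=> lt; have : nth z (enum (nbhd x)) n \in enum (nbhd x).
    by rewrite mem_nth // -cardE.
  by rewrite mem_enum inE.
by case: i j => [|i] [|j] //= le1 le2 _; rewrite ?leaf // sym leaf.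
Qed.

Lemma star_free_deg k : ~ contains (star_graph k) e -> forall x, deg e x < k.
Proof.
move=> nstar x; rewrite ltnNge; apply/negP=> le; case: nstar.
exists (fun i : 'I_k.+1 => nth x (star_seq x) i); split=> [i j /eqP|i j h].
  rewrite nth_uniq ?star_seq_uniq // ?size_star_seq; first by move/eqP/val_inj.
    exact: leq_trans (ltn_ord i) _.
  exact: leq_trans (ltn_ord j) _.
by apply: star_seq_edge => //; [have := ltn_ord i | have := ltn_ord j]; lia.
Qed.

(** If the closed neighbourhoods were disjoint, initial segments of the two [star_seq] would form
    two disjoint stars. *)
Lemma two_stars_free_meet k : ~ contains (two_stars_graph k) e ->
  forall u v, k.-1 <= deg e u -> k.-1 <= deg e v ->
  exists z, z \in (u |: nbhd u) :&: (v |: nbhd v).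
Proof.
move=> nstar u v leu lev; apply/set0Pn; apply/eqP=> dis; case: nstar.
pose c b := if b then u else v.
have lec b : k.-1 <= deg e (c b) by case: b.
have lt b (i : 'I_k.-1.+1) : i < size (star_seq (c b)).
  by rewrite size_star_seq ltnS; apply: leq_trans (lec b); rewrite -ltnS.
exists (fun p : bool * 'I_k.-1.+1 => nth u (star_seq (c p.1)) p.2).
split=> [[b i] [b' j]|[b i] [b' j]] /=.
  have [<-|neq] := eqVneq b b'.
    by move/eqP; rewrite nth_uniq ?star_seq_uniq // => /eqP/val_inj->.
  move=> eq; have := mem_nth u (lt b i); have := mem_nth u (lt b' j).
  rewrite -eq !mem_star_seq; move: (nth u _ i) => z h h'.
  have: z \in set0.
    by rewrite -dis inE; case: b b' neq h h' {eq} => [] [] //= _ -> ->.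
  by rewrite inE.
case/andP=> /= /eqP <- h; apply: star_seq_edge => //;
  by apply: leq_trans (lec b); rewrite -ltnS.
Qed.

(** A transversal [B] of the involution on the covered vertices picks one end of each matching
    edge. *)
Lemma matching_free_covered k f : ~ contains (matching_graph k) e ->
  matching e setT f -> #|covered f|./2 < k.
Proof.
move=> nmat /matchingP[fK fe].
have cf x : x \in covered f -> f x \in covered f by rewrite !inE fK eq_sym.
have cfK : {in covered f, forall x, f (f x) = x} by [].
have cfN : {in covered f, forall x, f x != x} by move=> x; rewrite inE.
have [B [eqB disB]] := involution_transversal cf cfK cfN.
rewrite (card_involution_transversal cfK eqB disB) doubleK ltnNge.
apply/negP=> le; case: nmat.
(* [nth] needs a default value in [T]; if [B] is empty then [k = 0] and the embedding has an empty
   domain. *)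
have [x0 _|/eq_card0 B0] := pickP (mem B); last first.
  have k0 : k = 0 by move: le; rewrite B0; lia.
  by subst k; exists (fun p : 'I_0 * bool => let: (i, _) := p in False_rect T (notF (valP i)));
     split=> [[[]]|[[]]].
pose g (i : 'I_k) := nth x0 (enum B) i.
have ltB (i : 'I_k) : i < size (enum B) by rewrite -cardE (leq_trans (ltn_ord i)).
have gB i : g i \in B by rewrite -mem_enum mem_nth.
have g_inj i j : g i = g j -> i = j.
  by move/eqP; rewrite nth_uniq ?enum_uniq // => /eqP/val_inj.
have neq i j : g i <> f (g j).
  move=> eq; have /negP[] := disjointFr disB (gB i).
  by rewrite eq imset_f.
have gc i : f (g i) != g i by apply: cfN; rewrite eqB inE gB.
exists (fun p : 'I_k * bool => if p.2 then g p.1 else f (g p.1)); split.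
  move=> [i []] [j []] /=; [by move/g_inj-> | by move/neq | by move/esym/neq |].
  by move/(congr1 f); rewrite !fK => /g_inj ->.
move=> [i b] [j b'] /andP[/= /eqP <-]; have [_ ee] := fe _ (gc i).
by case: b b' => [] [] //= _; rewrite sym.
Qed.

End Forbidden.

(** * Degree sums *)

Section Volume.
Variables (T : finType) (e : rel T).
Hypotheses (sym : symmetric e) (irr : irreflexive e).
Implicit Types A C S : {set T}.

Definition deg_in A x := #|[set y in A | e x y]|.

(** Twice the number of edges inside [A]. *)
Definition vol A := \sum_(x in A) deg_in A x.

(** Reversing arcs is a fixed-point-free involution, which yields both the evenness of [vol] and the
    handshake formula. *)
Definition arcs A := [set p : T * T | [&& p.1 \in A, p.2 \in A & e p.1 p.2]].

Lemma sum_deg_in A B :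
  \sum_(x in A) deg_in B x = \sum_(x in A) \sum_(y in B) e x y.
Proof.
apply: eq_bigr => x _; rewrite /deg_in -sum1_card big_mkcond [RHS]big_mkcond.
by apply: eq_bigr => y _; rewrite inE; case: (y \in B); case: (e x y).
Qed.

Lemma sum_deg_inC A B : \sum_(x in A) deg_in B x = \sum_(x in B) deg_in A x.
Proof.
rewrite !sum_deg_in exchange_big; apply: eq_bigr => x _; apply: eq_bigr => y _.
by rewrite sym.
Qed.

Lemma card_arcs A : #|arcs A| = vol A.
Proof.
rewrite /vol sum_deg_in pair_big /= -sum1_card big_mkcond [RHS]big_mkcond.
apply: eq_bigr => -[x y] _ /=; rewrite inE /=.
by case: (x \in A); case: (y \in A); case: (e x y).
Qed.

Lemma arcs_swap A : {in arcs A, forall p, (p.2, p.1) \in arcs A}.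
Proof. by move=> [x y]; rewrite !inE /= sym => /and3P[-> -> ->]. Qed.

Lemma arcs_swapK A : {in arcs A, forall p, ((p.2, p.1).2, (p.2, p.1).1) = p}.
Proof. by case. Qed.

Lemma arcs_swapN A : {in arcs A, forall p, (p.2, p.1) != p}.
Proof.
move=> [x y]; rewrite inE /= => /and3P[_ _ exy].
by apply/eqP=> -[eq _]; rewrite eq irr in exy.
Qed.

Lemma even_vol A : ~~ odd (vol A).
Proof.
rewrite -card_arcs.
exact: even_involution (@arcs_swap A) (@arcs_swapK A) (@arcs_swapN A).
Qed.

Lemma deg_inT x : deg_in setT x = deg e x.
Proof. by apply: eq_card => y; rewrite !inE. Qed.

Lemma handshake : \sum_x deg e x = (nedges e).*2.
Proof.
have -> : \sum_x deg e x = vol setT.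
  by rewrite /vol; apply: eq_big => [x|x _]; rewrite ?inE ?deg_inT.
rewrite -card_arcs.
have [B [eqB disB]] :=
  involution_transversal (@arcs_swap setT) (@arcs_swapK setT) (@arcs_swapN setT).
rewrite (card_involution_transversal (@arcs_swapK setT) eqB disB); congr _.*2.
rewrite -(card_in_imset (f := fun p : T * T => [set p.1; p.2]) (D := B)).
  apply: eq_card => E; apply/imsetP/imset2P => [[[x y] pB ->]|[x y _ exy ->]].
    have: (x, y) \in arcs setT by rewrite eqB inE pB.
    by rewrite !inE /= => exy; exists x y; rewrite ?inE.
  move: exy; rewrite inE => /= exy.
  have: (x, y) \in arcs setT by rewrite !inE.
  rewrite eqB inE => /orP[xyB|/imsetP[[y' x'] yxB [-> ->]]].
    by exists (x, y).
  by exists (y', x'); rewrite //= setUC.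
(* Two arcs on the same edge are equal or reverse to each other, and a transversal never contains an
   arc with its reverse. *)
move=> [x y] [x' y'] pB qB /= eq.
have: (x, y) \in arcs setT by rewrite eqB inE pB.
rewrite !inE /= => exy; have neq : x != y by apply/eqP=> h; rewrite h irr in exy.
have nB : (y', x') \notin B.
  apply/negP=> h; have /negP[] := disjointFr disB h.
  by apply/imsetP; exists (x', y').
have: x \in [set x'; y'] by rewrite -eq !inE eqxx.
have: y \in [set x'; y'] by rewrite -eq !inE eqxx orbT.
rewrite !inE => /orP[]/eqP hy /orP[]/eqP hx; subst => //.
- by rewrite eqxx in neq.
- by rewrite pB in nB.
- by rewrite eqxx in neq.
Qed.

Lemma deg_in_lt C x : x \in C -> deg_in C x < #|C|.
Proof.
move=> xC; apply/proper_card/properP; split.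
  by apply/subsetP=> y; rewrite inE => /andP[].
by exists x; rewrite // inE irr andbF.
Qed.

Lemma deg_in_le C x : deg_in C x <= deg e x.
Proof. by apply/subset_leq_card/subsetP=> y; rewrite !inE => /andP[]. Qed.

Lemma vol_le_clique C : vol C <= #|C| * #|C|.-1.
Proof.
rewrite -sum_nat_const; apply: leq_sum => x xC.
by have := deg_in_lt xC; lia.
Qed.

Lemma vol_le_max C d : (forall x, deg e x <= d) -> vol C <= #|C| * d.
Proof.
move=> le; rewrite -sum_nat_const; apply: leq_sum => x _.
exact: leq_trans (deg_in_le _ _) (le x).
Qed.

Lemma deg_split S x : deg e x = deg_in S x + deg_in (~: S) x.
Proof.
rewrite -deg_inT /deg_in -(cardsID S); congr (_ + _); apply: eq_card => y;
by rewrite !inE // andbC.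
Qed.

(** Edges leaving [S] contribute to degrees on both sides; the outer share is counted from [S],
    where a degree bound controls it. *)
Lemma sum_deg_split S :
  \sum_x deg e x =
    \sum_(x in S) deg e x + \sum_(x in S) deg_in (~: S) x + vol (~: S).
Proof.
rewrite (bigID (mem S)) /= -addnA; congr (_ + _).
rewrite sum_deg_inC /vol -big_split /=.
by apply: eq_big => [x|x _]; rewrite ?inE // (deg_split S).
Qed.

Lemma vol_partition (P : {set {set T}}) W :
  partition P W ->
  {in W &, forall x y, e x y -> pblock P x = pblock P y} ->
  vol W = \sum_(C in P) vol C.
Proof.
move=> parP edgeP; rewrite /vol (set_partition_big _ parP) /=.
apply: eq_bigr => C CP; apply: eq_bigr => x xC.
have sCW : C \subset W by rewrite -(cover_partition parP) bigcup_sup.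
have tP : trivIset P by case/and3P: parP.
apply: eq_card => y; rewrite !inE; have [exy|_] := boolP (e x y); last by rewrite !andbF.
rewrite !andbT; apply/idP/idP=> [yW|]; last exact: (subsetP sCW).
rewrite -(def_pblock tP CP xC) (edgeP x y (subsetP sCW _ xC) yW exy).
by rewrite mem_pblock (cover_partition parP).
Qed.

End Volume.

(** * Extremal counting *)

Lemma eq_sum_leq (I : finType) (A : {pred I}) (F G : I -> nat) :
  (forall i, i \in A -> F i <= G i) ->
  \sum_(i in A) F i = \sum_(i in A) G i -> forall i, i \in A -> F i = G i.
Proof.
move=> le eq i iA; move: eq; rewrite (bigD1 i) //= [RHS](bigD1 i) //=.
have := le i iA.
have: \sum_(j in A | j != i) F j <= \sum_(j in A | j != i) G j.
  by apply: leq_sum => j /andP[/le].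
lia.
Qed.

Section Extremal.
Variables (T : finType) (e : rel T) (d : nat).
Hypotheses (sym : symmetric e) (irr : irreflexive e).
Hypothesis max_deg : forall x, deg e x <= d.
Hypothesis meet : forall u v, deg e u = d -> deg e v = d ->
  exists z, z \in (u |: nbhd e u) :&: (v |: nbhd e v).
Variables (S : {set T}) (P : {set {set T}}).
Hypothesis parP : partition P (~: S).
Hypothesis edgeP :
  {in ~: S &, forall x y, e x y -> pblock P x = pblock P y}.
Hypothesis leSP : #|S| + \sum_(C in P) #|C|./2 <= d.
Hypothesis d_gt0 : 0 < d.

(* Only the big blocks can have more than [d] edges per unit of [#|C|./2]. *)
Definition big (C : {set T}) := odd #|C| && (d < #|C|).

Let tP : trivIset P. Proof. by case/and3P: parP. Qed.

Lemma block_notS C x : C \in P -> x \in C -> x \notin S.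
Proof.
move=> CP xC; have : x \in ~: S; last by rewrite inE.
by rewrite -(cover_partition parP); apply/bigcupP; exists C.
Qed.

Lemma block_edge C x y : C \in P -> x \in C -> e x y -> y \notin S -> y \in C.
Proof.
move=> CP xC exy yS; rewrite -(def_pblock tP CP xC) (edgeP _ _ exy) ?inE //.
  by rewrite mem_pblock (cover_partition parP) inE.
exact: block_notS CP xC.
Qed.

Lemma block_uniq C C' x : C \in P -> C' \in P -> x \in C -> x \in C' -> C = C'.
Proof.
by move=> CP CP' xC xC'; rewrite -(def_pblock tP CP xC) (def_pblock tP CP' xC').
Qed.

(** When [#|C|] is $2m+1>d$, the degree bound gives $2md+d$, and evenness of [vol] rounds the last
    $d$ down to [(d./2).*2]. An odd block with at most $d$ vertices uses the clique bound
    instead. *)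
Lemma vol_block_le C :
  vol e C <= d * (#|C|./2).*2 + (if big C then (d./2).*2 else 0).
Proof.
have h1 := vol_le_max C max_deg; have h2 := vol_le_clique irr C.
have h3 := even_vol sym irr C; rewrite /big.
have := odd_double_half #|C|; move: #|C|./2 => m eqc; rewrite -{}eqc in h1 h2 *.
case: (odd #|C|) h1 h2 => /= h1 h2; rewrite ?add0n ?odd_double /= in h1 h2 *; last lia.
case: ltnP => h; first by move: h1; rewrite mulnDl -!muln2; lia.
rewrite addn0; apply: leq_trans h2 _; rewrite add1n /= leq_mul2r; apply/orP; right.
by lia.
Qed.

Lemma vol_block0 (C : {set T}) : #|C|./2 = 0 -> vol e C = 0.
Proof. by move=> h; have := vol_le_clique irr C; nia. Qed.

Lemma sum_deg_blocks :
  \sum_x deg e x = \sum_(x in S) deg e x + \sum_(x in S) deg_in e (~: S) x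
                   + \sum_(C in P) vol e C.
Proof. by rewrite (sum_deg_split sym S) (vol_partition parP edgeP). Qed.

Lemma sum_deg_S : \sum_(x in S) deg e x <= #|S| * d.
Proof. by rewrite -sum_nat_const; apply: leq_sum. Qed.

Lemma sum_deg_in_S A : \sum_(x in S) deg_in e A x <= #|S| * d.
Proof.
by apply: leq_trans sum_deg_S; apply: leq_sum => x _; apply: deg_in_le.
Qed.

Lemma deg_in_block C x : S = set0 -> C \in P -> x \in C -> deg_in e C x = deg e x.
Proof.
move=> S0 CP xC; apply: eq_card => y; rewrite !inE.
have [exy|] := boolP (e x y); rewrite ?andbF // andbT.
by apply: (block_edge CP xC exy); rewrite S0 inE.
Qed.

Lemma two_big_blocks C1 C2 : C1 \in P -> C2 \in P -> C1 != C2 ->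
  big C1 -> big C2 -> \sum_x deg e x < (d * d).*2 + (d./2).*2.
Proof.
wlog: C1 C2 / forall x, x \in C2 -> deg e x < d.
  move=> IH P1 P2 neq b1 b2.
  have [/forall_inP H|] := boolP [forall x in C2, deg e x < d].
    exact: (IH C1 C2).
  have [/forall_inP H|] := boolP [forall x in C1, deg e x < d].
    by move=> _; apply: (IH C2 C1) => //; rewrite eq_sym.
  rewrite !negb_forall_in => /exists_inP[u uC du] /exists_inP[v vC dv].
  have {}du : deg e u = d by move: (max_deg u) du; lia.
  have {}dv : deg e v = d by move: (max_deg v) dv; lia.
  have S0 : S = set0.
    apply/eqP; rewrite -cards_eq0; move: leSP b1 b2; rewrite /big.
    rewrite (bigD1 C1) //= (bigD1 C2) /=; last by rewrite P2 eq_sym.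
    lia.
  have sub C x : C \in P -> x \in C -> {subset x |: nbhd e x <= C}.
    move=> CP xC y; rewrite !inE => /orP[/eqP->//|exy].
    by apply: (block_edge CP xC exy); rewrite S0 inE.
  have [z /setIP[/(sub _ _ P1 uC) z1 /(sub _ _ P2 vC) z2]] := meet du dv.
  by rewrite (block_uniq P1 P2 z1 z2) eqxx in neq.
move=> small P1 P2 neq b1 b2.
pose R := \sum_(C in P | (C != C1) && (C != C2)) #|C|./2.
have le : #|S| + (#|C1|./2 + (#|C2|./2 + R)) <= d.
  have := leSP; rewrite (bigD1 C1) //= (bigD1 C2) /=; last by rewrite P2 eq_sym.
  by rewrite /R (eq_bigl _ _ (fun C => andbA _ _ _)).
(* A big block has [#|C|./2] at least $d/2$, so two of them exhaust the budget [d]: nothing is left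
   for [S], and all other blocks have at most one vertex. *)
have S0 : #|S| = 0 by move: b1 b2; rewrite /big; lia.
have rest0 : R = 0 by move: b1 b2; rewrite /big; lia.
have volP : \sum_(C in P) vol e C = vol e C1 + vol e C2.
  rewrite (bigD1 C1) //= (bigD1 C2) /=; last by rewrite P2 eq_sym.
  rewrite big1 ?addn0 // => C /andP[/andP[CP n1] n2]; apply: vol_block0; apply/eqP.
  move/eqP: rest0; rewrite sum_nat_eq0 => /forall_inP; apply.
  by rewrite CP n1.
have v1 := vol_le_max C1 max_deg.
have v2 : vol e C2 <= #|C2| * d.-1.
  rewrite -sum_nat_const; apply: leq_sum => x xC; have := small x xC.
  by move: (deg_in_le e C2 x); clear; lia.
have c1 : #|C1| = d.+1 by move: b1 b2; rewrite /big; lia.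
have c2 : #|C2| = d.+1 by move: b1 b2; rewrite /big; lia.
have ev : ~~ odd d by move: b1; rewrite /big c1 /=; case: odd.
(* The total is at most $(d+1)d+(d+1)(d-1)=2d^2+d-1$, below the bound $2d^2+d$ for even $d$. *)
rewrite sum_deg_blocks volP; have := sum_deg_S; have := sum_deg_in_S (~: S).
rewrite S0 mul0n; rewrite c1 in v1; rewrite c2 in v2.
have -> : (d./2).*2 = d by rewrite even_halfK.
nia.
Qed.

Lemma others_le C0 : (forall C, C \in P -> big C -> C = C0) ->
  \sum_(C in P | C != C0) vol e C <= d * (\sum_(C in P | C != C0) #|C|./2).*2.
Proof.
move=> uniq; rewrite -muln2 mulnA big_distrr big_distrl /=; apply: leq_sum => C.
case/andP=> CP neq; have := vol_block_le C.
by case: ifP => [/(uniq _ CP) eq|_]; [rewrite eq eqxx in neq | lia].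
Qed.

Lemma no_big_blocks : (forall C, C \in P -> ~~ big C) ->
  \sum_x deg e x <= (d * d).*2.
Proof.
move=> nob; rewrite sum_deg_blocks.
have h : \sum_(C in P) vol e C <= d * (\sum_(C in P) #|C|./2).*2.
  rewrite -muln2 mulnA big_distrr big_distrl /=; apply: leq_sum => C CP.
  by have := vol_block_le C; rewrite (negbTE (nob _ CP)); lia.
have := leq_mul (leqnn d) leSP; have := sum_deg_S; have := sum_deg_in_S (~: S).
lia.
Qed.

(** Each unit of the left side of [leSP] accounts for at most $2d$ in the degree sum; a single big
    block adds [(d./2).*2]. *)
Lemma sum_deg_le : \sum_x deg e x <= (d * d).*2 + (d./2).*2.
Proof.
have [/exists_inP[C0 P0 b0]|] := boolP [exists C in P, big C]; last first.
  rewrite negb_exists_in => /forall_inP nob.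
  by apply: leq_trans (no_big_blocks nob) _; rewrite leq_addr.
have [/exists_inP[C1 P1 /andP[neq b1]]|] :=
  boolP [exists C in P, (C != C0) && big C].
  by apply: ltnW; apply: two_big_blocks P1 P0 neq b1 b0.
rewrite negb_exists_in => /forall_inP uniq.
have {}uniq C : C \in P -> big C -> C = C0.
  by move=> CP bC; apply/eqP; move: (uniq C CP); rewrite bC andbT negbK.
pose M := \sum_(C in P | C != C0) #|C|./2.
pose R := \sum_(C in P | C != C0) vol e C.
have le_o : R <= d * M.*2 := others_le uniq.
have leM : #|S| + (#|C0|./2 + M) <= d by have := leSP; rewrite (bigD1 C0).
rewrite sum_deg_blocks (_ : \sum_(C in P) vol e C = vol e C0 + R); last exact: bigD1.
have := vol_block_le C0; rewrite b0.
have := leq_mul (leqnn d) leM; have := sum_deg_S; have := sum_deg_in_S (~: S).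
lia.
Qed.

(** A union of components forming an $R(|C|,d)$, described inside [T]. *)
Definition near_regular_block (C : {set T}) :=
  [/\ forall x y, x \in C -> e x y -> y \in C,
      forall x, x \in C -> deg e x = d \/ deg e x = d.-1 &
      #|[set x in C | deg e x != d]| <= 1].

(** As [1 < d] makes [(d./2).*2] positive, equality requires a big block, unique because
    [two_big_blocks] is strict. All the estimates behind [sum_deg_le] are then tight. *)
Lemma sum_deg_eq : 1 < d -> \sum_x deg e x = (d * d).*2 + (d./2).*2 ->
  exists2 C, near_regular_block C &
    (#|C| = d.*2.+1 /\ non_isolated e \subset C) \/
    [/\ odd d, #|C| = d.+2 & exists C' : {set T},
      [/\ #|C'| = d, [disjoint C & C'], non_isolated e \subset C :|: C' &
          {in C' &, forall x y, e x y = (x != y)}]].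
Proof.
move=> d1 eqd.
have [/exists_inP[C0 P0 b0]|] := boolP [exists C in P, big C]; last first.
  rewrite negb_exists_in => /forall_inP nob.
  by have := no_big_blocks nob; lia.
have [/exists_inP[C1 P1 /andP[neq b1]]|] :=
  boolP [exists C in P, (C != C0) && big C].
  by have := two_big_blocks P1 P0 neq b1 b0; rewrite eqd ltnn.
rewrite negb_exists_in => /forall_inP uniq.
have {}uniq C : C \in P -> big C -> C = C0.
  by move=> CP bC; apply/eqP; move: (uniq C CP); rewrite bC andbT negbK.
pose M := \sum_(C in P | C != C0) #|C|./2.
pose R := \sum_(C in P | C != C0) vol e C.
have le_o : R <= d * M.*2 := others_le uniq.
have := vol_block_le C0; rewrite b0 => le_0.
have leS1 := sum_deg_S; have leS2 := sum_deg_in_S (~: S).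
have leM : #|S| + (#|C0|./2 + M) <= d by have := leSP; rewrite (bigD1 C0).
move: eqd; rewrite sum_deg_blocks (_ : \sum_(C in P) vol e C = vol e C0 + R); last first.
  exact: bigD1.
move=> eqd.
have le_d : d * (#|S| + (#|C0|./2 + M)) <= d * d by rewrite leq_mul2l leM orbT.
have eqM : #|S| + (#|C0|./2 + M) = d.
  apply/eqP; rewrite -(eqn_pmul2l d_gt0) eqn_leq le_d /=; lia.
have eqS : \sum_(x in S) deg e x = \sum_(x in S) d by rewrite sum_nat_const; lia.
have eq0 : vol e C0 = d * (#|C0|./2).*2 + (d./2).*2 by lia.
have eqo : R = d * M.*2 by lia.
have degS : forall u, u \in S -> deg e u = d.
  by apply: (eq_sum_leq _ eqS) => x _.
(* By tightness the total deficiency of [C0] is $d-2\lfloor d/2\rfloor$, the parity of $d$. *)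
have deficit : \sum_(x in C0) (d - deg_in e C0 x) <= 1.
  have : \sum_(x in C0) (d - deg_in e C0 x) + vol e C0 = #|C0| * d.
    rewrite -sum_nat_const -big_split /=; apply: eq_bigr => x _.
    by rewrite subnK // (leq_trans (deg_in_le _ _ _)).
  rewrite eq0; have := odd_double_half #|C0|; move/andP: b0 => [-> _].
  have := odd_double_half d; case: (odd d) => /=; nia.
clear eqS eq0 le_0 le_d leS1 leS2 eqd leM le_o.
have exc1 : #|[set x in C0 | deg_in e C0 x != d]| <= 1.
  apply: leq_trans deficit; rewrite -sum1_card big_mkcond [X in _ <= X]big_mkcond /=.
  apply: leq_sum => x _; rewrite inE; case: (x \in C0) => //=.
  by have := deg_in_le e C0 x; have := max_deg x; case: eqP => //=; lia.
have near x : x \in C0 -> deg_in e C0 x = d \/ deg_in e C0 x = d.-1.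
  move=> xC; have := deficit; rewrite (bigD1 x) //=.
  have := deg_in_le e C0 x; have := max_deg x; lia.
have exc x y : x \in C0 -> y \in C0 -> deg_in e C0 x != d -> deg_in e C0 y != d -> x = y.
  by move=> xC yC hx hy; apply: (card_le1_eqP exc1); rewrite inE ?xC ?yC.
have /andP[oddC ltC] := b0.
have full_in w y : w \in C0 -> deg_in e C0 w = d -> e w y -> y \in C0.
  move=> wC hw ewy; have eqw : [set y in C0 | e w y] = nbhd e w.
    apply/eqP; rewrite eqEcard; apply/andP; split.
      by apply/subsetP=> z; rewrite !inE => /andP[].
    by rewrite -[X in X <= _]/(deg e w) -[X in _ <= X]/(deg_in e C0 w) hw.
  have : y \in nbhd e w by rewrite inE.
  by rewrite -eqw inE => /andP[].
have S0 : S = set0.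
  apply/eqP; apply: contraT => /set0Pn[u uS].
  have uC : u \notin C0 by apply/negP=> /(block_notS P0); rewrite uS.
  (* All neighbours of such a [w] lie in [C0], so its closed neighbourhood can meet that of [u] only
     in a common neighbour inside [C0]. *)
  have common w : w \in C0 -> deg_in e C0 w = d ->
      exists2 z, z \in C0 /\ e z u & e w z.
    move=> wC hw; have hdw : deg e w = d.
      by have := deg_in_le e C0 w; have := max_deg w; lia.
    have [z] := meet (degS u uS) hdw; rewrite !inE.
    case/andP=> /orP[/eqP->|euz] /orP[/eqP eq|ewz].
    - by rewrite eq wC in uC.
    - by rewrite (full_in _ _ wC hw ewz) in uC.
    - by rewrite eq sym in euz; rewrite (full_in _ _ wC hw euz) in uC.
    - by exists z; rewrite // sym; split=> //; apply: full_in ewz.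
  have exz z : z \in C0 -> e z u -> deg_in e C0 z != d.
    move=> zC ezu; apply: contraNneq uC => hz; exact: full_in ezu.
  have [w wC hw] : exists2 w, w \in C0 & deg_in e C0 w = d.
    have: 0 < #|C0 :\: [set x in C0 | deg_in e C0 x != d]|.
      rewrite cardsD; have := subset_leq_card (subsetIr C0 [set x in C0 | deg_in e C0 x != d]).
      lia.
    rewrite card_gt0 => /set0Pn[w]; rewrite !inE => /andP[h wC]; exists w => //.
    by move: h; rewrite wC /= negbK => /eqP.
  have [z [zC ezu] _] := common w wC hw.
  (* Any other vertex [y] of [C0] has full degree inside, and shares with [u] a neighbour that is
     deficient, hence equal to [z]. So [z] is adjacent to the at least [d] other vertices of
     [C0]. *)
  have: d <= deg_in e C0 z.
    apply: (@leq_trans #|C0|.-1); first by move: ltC; clear; lia.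
    have -> : #|C0|.-1 = #|C0 :\ z| by rewrite (cardsD1 z C0) zC.
    apply/subset_leq_card/subsetP=> y; rewrite !inE => /andP[yz yC].
    rewrite yC /=; have hy : deg_in e C0 y = d.
      apply/eqP; apply: contraNT yz => hy; apply/eqP; apply: exc => //; exact: exz.
    have [z' [zC' ezu'] eyz] := common y yC hy.
    by rewrite sym (exc z z') //; apply: exz.
  have := exz z zC ezu; have := leq_trans (deg_in_le e C0 z) (max_deg z).
  by clear; lia.
have degC C x : C \in P -> x \in C -> deg_in e C x = deg e x by apply: deg_in_block.
have vol_o C : C \in P -> C != C0 -> vol e C = d * (#|C|./2).*2.
  move=> CP neq.
  apply: (@eq_sum_leq _ [pred C in P | C != C0] (vol e) (fun C => d * (#|C|./2).*2)).
  - move=> B /andP[BP Bn]; have := vol_block_le B.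
    by case: ifP => [/(uniq _ BP) eq|_]; [rewrite eq eqxx in Bn | rewrite addn0].
  - rewrite [LHS]eqo /M -muln2 mulnA big_distrr big_distrl /=.
    by apply: eq_bigr => B _; rewrite -muln2 mulnA.
  - by rewrite inE CP.
exists C0.
  split.
  - by move=> x y xC exy; apply: (block_edge P0 xC exy); rewrite S0 inE.
  - by move=> x xC; rewrite -(degC C0) //; apply: near.
  - rewrite (_ : [set _ in _ | _] = [set x in C0 | deg_in e C0 x != d]) //.
    by apply/setP=> x; rewrite !inE; case xC : (x \in C0); rewrite //= degC.
rewrite S0 cards0 add0n in eqM.
have noniso x : x \in non_isolated e ->
    exists C, [/\ C \in P, x \in C & 0 < #|C|./2].
  rewrite inE => /existsP[y exy].
  have xcov : x \in cover P by rewrite (cover_partition parP) S0 !inE.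
  exists (pblock P x); rewrite pblock_mem // mem_pblock; split=> //.
  have CP := pblock_mem xcov; have xC : x \in pblock P x by rewrite mem_pblock.
  have yC : y \in pblock P x by apply: (block_edge CP xC exy); rewrite S0 inE.
  have : 1 < #|pblock P x|; last by clear; lia.
  apply/card_gt1P; exists x, y; split=> //.
  by apply/eqP=> eq; rewrite eq irr in exy.
(* If no other block has two vertices, then [M = 0] and [C0] has $2d+1$ vertices. *)
have [/exists_inP[C' P' /andP[neq m']]|] :=
  boolP [exists C in P, (C != C0) && (0 < #|C|./2)]; last first.
  rewrite negb_exists_in => /forall_inP all0; left; split.
    have : M = 0.
      apply: big1 => C /andP[CP Cn]; have := all0 C CP; rewrite Cn; lia.
    lia.
  apply/subsetP=> x /noniso[C [CP xC mC]].
  by have := all0 C CP; rewrite mC andbT negbK => /eqP <-.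
right.
have leM' : #|C'|./2 <= M by rewrite /M (bigD1 C') ?P' //= leq_addr.
have volC' := vol_o C' P' neq.
have nbig : ~~ big C' by apply: contra neq => /(uniq _ P') ->.
have cl := vol_le_clique irr C'.
(* Compare the tight volume with the clique bound. For odd [#|C'|], at most [d] since [C'] is not
   big, this gives [d <= #|C'|]; for even [#|C'|] it gives [d < #|C'|], which together with [C0]
   exceeds the budget. *)
have [oddC' cardC'] : odd d /\ #|C'| = d.
  move: nbig; rewrite /big volC' in cl *.
  have := odd_double_half #|C'|; case oc : (odd #|C'|) => /= eqc.
    rewrite -leqNgt => le; have : #|C'| = d; last by move=> <-; rewrite oc.
    move: cl; rewrite -[#|C'|.-1](_ : (#|C'|./2).*2 = _); last by lia.
    rewrite leq_pmul2r; lia.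
  move=> _; exfalso.
  have ec : (#|C'|./2).*2 = #|C'| by lia.
  by move: cl; rewrite ec mulnC leq_pmul2l; lia.
(* Both [d] and [#|C0|] are odd, so [C0] has at least $d+2$ vertices; the shares $(d+1)/2$ and
   $(d-1)/2$ of [C0] and [C'] already use up [d]. *)
have MC : M = #|C'|./2.
  by move: eqM leM' cardC' oddC oddC' ltC; clear; lia.
split=> //.
  by move: eqM MC oddC' oddC cardC'; clear; lia.
exists C'; split=> //.
- rewrite -setI_eq0; apply/eqP/setP=> x; rewrite !inE; apply/negP=> /andP[x0 x'].
  by rewrite (block_uniq P0 P' x0 x') eqxx in neq.
- apply/subsetP=> x /noniso[C [CP xC mC]]; rewrite inE.
  have [<-|nC0] := eqVneq C C0; first by rewrite xC.
  have [<-|nC'] := eqVneq C C'; first by rewrite xC orbT.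
  move: MC; rewrite /M (bigD1 C') ?P' //= (bigD1 C) ?CP ?nC0 ?nC' //=.
  by move: mC; clear; lia.
(* The volume of [C'] is $d(d-1)$, so the clique bound is attained at every vertex. *)
have full : forall x, x \in C' -> deg_in e C' x = #|C'|.-1.
  apply: eq_sum_leq => [x xC|].
    by move: (deg_in_lt irr xC); clear; lia.
  rewrite sum_nat_const [LHS]volC' cardC'; congr (_ * _).
  by move: oddC'; clear; lia.
move=> x y xC yC; have [<-|xy] := eqVneq x y; first by rewrite irr.
have eqN : [set z in C' | e x z] = C' :\ x.
  apply/eqP; rewrite eqEcard; apply/andP; split.
    apply/subsetP=> z; rewrite !inE => /andP[-> exz]; rewrite andbT.
    by apply/eqP=> eq; rewrite eq irr in exz.
  by rewrite -[X in _ <= X]/(deg_in e C' x) full // (cardsD1 x C') xC add1n.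
have : y \in C' :\ x by rewrite !inE yC eq_sym xy.
by rewrite -eqN inE => /andP[].
Qed.

End Extremal.

(** * Isomorphism up to isolated vertices *)

(** Doubling removes the division and matches the degree-sum bound. *)
Lemma g1E d : (g1 d.+1).*2 = (d * d).*2 + (d./2).*2.
Proof.
rewrite /g1 /= subn1 /=; have := odd_double_half d; move: d./2 => m.
case: (odd d) => /= <-.
  rewrite (_ : _ * _ = (m.+1 * (4 * m + 1)) * 2) ?mulnK //; lia.
rewrite (_ : _ * _ = (m * (4 * m + 1)) * 2) ?mulnK //; lia.
Qed.

Lemma sum_deg_almost_regular (U : finType) (r : rel U) d :
  almost_regular r d -> exists2 c, c <= 1 & \sum_x deg r x + c = #|U| * d.
Proof.
case=> near exc1; exists (\sum_x (d - deg r x)).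
  apply: leq_trans exc1; rewrite -sum1_card [X in _ <= X]big_mkcond /=.
  by apply: leq_sum => x _; rewrite inE; case: (near x) => ->; case: eqP => //=; lia.
rewrite -big_split /= -sum_nat_const; apply: eq_bigr => x _.
by case: (near x) => ->; lia.
Qed.

(** Isolated vertices add nothing to the sum, and [f] carries the neighbourhood of a non-isolated
    vertex bijectively to that of its image. *)
Lemma iso_sum_deg (T U : finType) (e : rel T) (h : rel U) :
  symmetric e -> symmetric h -> iso_upto_isolated e h ->
  \sum_x deg e x = \sum_u deg h u.
Proof.
move=> syme symh [f [finj [fe fim]]].
have restr (V : finType) (g : rel V) : \sum_x deg g x = \sum_(x in non_isolated g) deg g x.
  rewrite [RHS]big_mkcond; apply: eq_bigr => x _; case: ifP => //.
  rewrite inE => /negbT; rewrite negb_exists => /forallP no.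
  by apply: eq_card0 => y; rewrite inE (negbTE (no y)).
rewrite !restr -fim big_imset //=; apply: eq_bigr => x xN.
have nbN y : e x y -> y \in non_isolated e.
  by move=> exy; rewrite inE; apply/existsP; exists x; rewrite syme.
rewrite /deg -(card_in_imset (f := f) (D := [set y | e x y])); last first.
  by move=> y z; rewrite !inE => /nbN yN /nbN zN; apply: finj.
apply: eq_card => u; rewrite [RHS]inE; apply/imsetP/idP => [[y]|hu].
  by rewrite inE => exy ->; rewrite (fe x y xN (nbN y exy)).
have : u \in f @: non_isolated e.
  by rewrite fim inE; apply/existsP; exists (f x); rewrite symh.
by case/imsetP=> y yN eq; exists y; rewrite // inE -(fe x y xN yN) -eq.
Qed.

Lemma sum_deg_union_clique m n (r : rel 'I_m) :
  \sum_x deg (union_with_clique n r) x = \sum_x deg r x + n * n.-1.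
Proof.
rewrite big_sumType /=; congr (_ + _).
  apply: eq_bigr => i _; rewrite /deg -[RHS](card_imset _ (@inl_inj 'I_m 'I_n)).
  apply: eq_card => -[j|j]; rewrite inE.
    by rewrite (mem_imset _ _ (@inl_inj 'I_m 'I_n)) inE.
  by apply/esym/negP=> /imsetP[].
rewrite (eq_bigr (fun _ => n.-1)) ?sum_nat_const ?card_ord // => i _.
have <- : #|[set~ i]| = n.-1 by rewrite cardsC1 card_ord.
rewrite /deg -[RHS](card_imset _ (@inr_inj 'I_m 'I_n)); apply: eq_card => -[j|j].
  by rewrite inE; apply/esym/negP=> /imsetP[].
by rewrite inE (mem_imset _ _ (@inr_inj 'I_m 'I_n)) !inE eq_sym.
Qed.

Lemma inj_in_ord (T : finType) (A : {set T}) n :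
  0 < n -> #|A| <= n -> exists f : T -> 'I_n, {in A &, injective f}.
Proof.
case: n => // n _ le; exists (fun x => inord (index x (enum A))) => x y xA yA.
move/(congr1 val); rewrite /= !inordK.
- by apply: (index_inj x); rewrite mem_enum.
- by apply: leq_trans le; rewrite cardE index_mem mem_enum.
- by apply: leq_trans le; rewrite cardE index_mem mem_enum.
Qed.

(** * Copying a union of components onto an ordinal *)

Section Transport.
Variables (T : finType) (e : rel T) (C : {set T}) (n d : nat).
Hypotheses (sym : symmetric e) (irr : irreflexive e).
Hypothesis closedC : forall x y, x \in C -> e x y -> y \in C.
Variable f : T -> 'I_n.
Hypothesis f_inj : {in C &, injective f}.

(** When [n] exceeds [#|C|], the surplus vertices are isolated. *)
Definition image_graph : rel 'I_n :=
  fun i j => [exists x in C, exists y in C, [&& f x == i, f y == j & e x y]].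

Lemma image_graphP i j : reflect
  (exists x y, [/\ x \in C, y \in C, f x = i, f y = j & e x y]) (image_graph i j).
Proof.
apply: (iffP exists_inP) => [[x xC /exists_inP[y yC /and3P[/eqP fx /eqP fy exy]]]|].
  by exists x, y.
case=> x [y [xC yC fx fy exy]]; exists x => //; apply/exists_inP; exists y => //.
by rewrite fx fy !eqxx.
Qed.

Lemma image_graphE : {in C &, forall x y, image_graph (f x) (f y) = e x y}.
Proof.
move=> x y xC yC; apply/image_graphP/idP => [[x' [y' [xC' yC']]]|exy].
  by move=> /(f_inj xC' xC) -> /(f_inj yC' yC) ->.
by exists x, y.
Qed.

Lemma image_graph_simple : simple_graph image_graph.
Proof.
split=> [i j|i].
  by apply/image_graphP/image_graphP => -[x [y [xC yC fx fy exy]]];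
     exists y, x; rewrite sym.
apply/image_graphP=> -[x [y [xC yC fx fy]]].
by rewrite (f_inj xC yC) ?irr // fx fy.
Qed.

Lemma deg_image_graph x : x \in C -> deg image_graph (f x) = deg e x.
Proof.
move=> xC; rewrite /deg -[RHS](card_in_imset (f := f)); last first.
  move=> y z; rewrite !inE => exy exz; apply: f_inj; exact: closedC xC _.
apply: eq_card => i; rewrite inE; apply/idP/imsetP => [|[y]].
  case/image_graphP=> x' [y [xC' yC fx fy exy]]; exists y => //.
  by rewrite inE -(f_inj xC' xC fx).
by rewrite inE => exy ->; rewrite image_graphE ?(closedC xC exy).
Qed.

Lemma deg_image_graph_out i : i \notin f @: C -> deg image_graph i = 0.
Proof.
move=> iC; apply: eq_card0 => j; rewrite inE; apply/image_graphP.
by case=> x [y [xC _ fx _ _]]; rewrite -fx imset_f in iC.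
Qed.

(** A surplus vertex has degree 0, which is [d] or [d.-1] exactly when [d <= 1]; it may then be the
    one deficient vertex. *)
Lemma image_graph_almost_regular :
  (forall x, x \in C -> deg e x = d \/ deg e x = d.-1) ->
  #|[set x in C | deg e x != d]| + (n - #|C|) <= 1 ->
  (#|C| < n -> d <= 1) ->
  almost_regular image_graph d.
Proof.
move=> near exc small.
have cardfC : #|f @: C| = #|C| by rewrite card_in_imset.
have cardn : #|~: (f @: C)| = n - #|C| by rewrite cardsCs setCK card_ord cardfC.
split=> [i|].
  have [/imsetP[x xC ->]|iC] := boolP (i \in f @: C).
    by rewrite deg_image_graph //; apply: near.
  rewrite deg_image_graph_out //; right.
  have : 0 < #|~: (f @: C)| by apply/card_gt0P; exists i; rewrite inE.
  by rewrite cardn subn_gt0 => /small; case: d => [|[]].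
apply: leq_trans exc; rewrite -cardn.
apply: leq_trans (_ : #|f @: [set x in C | deg e x != d] :|: ~: (f @: C)| <= _).
  apply/subset_leq_card/subsetP=> i; rewrite !inE => ne.
  have [/imsetP[x xC eqi]|_] := boolP (i \in f @: C); last by rewrite orbT.
  by rewrite eqi imset_f // inE xC -deg_image_graph // -eqi.
by rewrite cardsU (leq_trans (leq_subr _ _)) // leq_add2r leq_imset_card.
Qed.

Lemma image_graph_iso : non_isolated e \subset C -> iso_upto_isolated e image_graph.
Proof.
move=> /subsetP sub; exists f; split; [|split].
- by move=> x y /sub xC /sub yC; apply: f_inj.
- by move=> x y /sub xC /sub yC; apply: image_graphE.
apply/setP=> i; rewrite [RHS]inE; apply/imsetP/existsP => [[x]|[j]].
  move=> xN ->; have := xN; rewrite inE => /existsP[y exy]; exists (f y).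
  by rewrite image_graphE // ?(closedC _ exy) // sub.
case/image_graphP=> x [y [xC yC fx fy exy]]; exists x => //.
by rewrite inE; apply/existsP; exists y.
Qed.

(** [C] is sent to the first summand by [f], and [C'] to the clique by an arbitrary bijection. *)
Lemma image_graph_iso_union (C' : {set T}) m :
  0 < m -> #|C'| = m -> [disjoint C & C'] ->
  non_isolated e \subset C :|: C' ->
  {in C' &, forall x y, e x y = (x != y)} ->
  iso_upto_isolated e (union_with_clique m image_graph).
Proof.
move=> m0 cardC' dis /subsetP sub clique.
have [g g_inj] : exists g : T -> 'I_m, {in C' &, injective g}.
  by apply: inj_in_ord; rewrite ?cardC'.
have gsurj j : exists2 x, x \in C' & j = g x.
  apply/imsetP; suff -> : g @: C' = setT by rewrite inE.
  by apply/eqP; rewrite eqEcard subsetT cardsT card_ord card_in_imset ?cardC' /=.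
have notC x : x \in C' -> x \notin C by move=> xC'; rewrite (disjointFl dis xC').
pose F x : 'I_n + 'I_m := if x \in C then inl (f x) else inr (g x).
have inC' x : x \in non_isolated e -> x \notin C -> x \in C'.
  by move=> /sub; rewrite inE => /orP[->|].
have FE x y : x \in non_isolated e -> y \in non_isolated e ->
    union_with_clique m image_graph (F x) (F y) = e x y.
  move=> xN yN; rewrite /F; case: ifPn => xC; case: ifPn => yC /=.
  - exact: image_graphE.
  - by apply/esym; apply: contraNF yC; apply: closedC.
  - by apply/esym; apply: contraNF xC; rewrite sym; apply: closedC.
  - rewrite clique ?inC' //; congr negb; apply/eqP/eqP => [|->//].
    by apply: g_inj; apply: inC'.
exists F; split; [|split] => //.
  move=> x y xN yN; rewrite /F; case: ifPn => xC; case: ifPn => yC // -[].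
    exact: f_inj.
  by apply: g_inj; apply: inC'.
apply/setP=> i; rewrite [RHS]inE; apply/imsetP/existsP => [[x xN ->]|[j]].
  have := xN; rewrite inE => /existsP[y exy]; exists (F y).
  by rewrite FE //; rewrite inE; apply/existsP; exists x; rewrite sym.
case: i j => [i|i] [j|j] //=.
  case/image_graphP=> x [y [xC yC fx fy exy]]; exists x; rewrite /F ?xC ?fx //.
  by rewrite inE; apply/existsP; exists y.
have [x xC' ->] := gsurj i; have [y yC' ->] := gsurj j => neq.
exists x; rewrite /F ?(negbTE (notC x xC')) //.
rewrite inE; apply/existsP; exists y; rewrite clique //.
by apply: contra_neq neq => ->.
Qed.

End Transport.

(** * The bound and its extremal graphs *)

Unset Implicit Arguments.

Theorem theorem1p3 (T : finType) (e : rel T) (k : nat) :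
  0 < k -> simple_graph e ->
  ~ contains (star_graph k) e ->
  ~ contains (matching_graph k) e ->
  ~ contains (two_stars_graph k) e ->
  nedges e <= g1 k /\
  (nedges e = g1 k <->
     (exists r : rel 'I_(2 * k - 1),
         simple_graph r /\ almost_regular r (k - 1) /\ iso_upto_isolated e r)
     \/
     (~~ odd k /\
      exists r : rel 'I_(k + 1),
         simple_graph r /\ almost_regular r (k - 1) /\
         iso_upto_isolated e (union_with_clique (k - 1) r))).
Proof.
case: k => // d _ [sym irr] nstar nmat ntwo.
have max_deg x : deg e x <= d by rewrite -ltnS; apply: star_free_deg.
have meet u v : deg e u = d -> deg e v = d ->
    exists z, z \in (u |: nbhd e u) :&: (v |: nbhd e v).
  by move=> du dv; apply: (two_stars_free_meet sym irr ntwo); rewrite /= ?du ?dv.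
have [S [P [_ parP edgeP leP]]] := berge_tutte_in sym irr [set: T].
rewrite setTD in parP edgeP.
have leSP : #|S| + \sum_(C in P) #|C|./2 <= d.
  have [f fmax] := max_matching_exists e setT; have [fm _] := andP fmax.
  have := leP f fmax; have := matching_free_covered sym nmat fm; lia.
have hs := handshake sym irr; have hg := g1E d.
have d1 : d.+1 - 1 = d by rewrite subn1.
have n1 : 2 * d.+1 - 1 = d.*2.+1 by lia.
rewrite d1; split; last split.
- case: (posnP d) => [d0|d_gt0].
    have : \sum_x deg e x = 0 by rewrite big1 // => x _; have := max_deg x; lia.
    lia.
  have := sum_deg_le sym irr max_deg meet parP edgeP leSP d_gt0; lia.
- move=> eqg; have eqd : \sum_x deg e x = (d * d).*2 + (d./2).*2 by lia.
  case: (ltnP 1 d) => [lt1d|led1].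
    have [C [clC near exc] [[cardC sub]|[oddd cardC [C' [cardC' dis sub cl]]]]] :=
      sum_deg_eq sym irr max_deg meet parP edgeP leSP (ltnW lt1d) lt1d eqd.
      left; have [f finj] : exists f : T -> 'I_(2 * d.+1 - 1), {in C &, injective f}.
        by apply: inj_in_ord; rewrite n1 ?cardC.
      exists (image_graph e C f); split; last split.
      + exact: image_graph_simple.
      + by apply: image_graph_almost_regular => //; rewrite cardC n1; lia.
      + exact: image_graph_iso.
    right; split; first by rewrite /= oddd.
    have [f finj] : exists f : T -> 'I_(d.+1 + 1), {in C &, injective f}.
      by apply: inj_in_ord; rewrite addn1 ?cardC.
    exists (image_graph e C f); split; last split.
    + exact: image_graph_simple.
    + by apply: image_graph_almost_regular => //; rewrite cardC; lia.
    + exact: image_graph_iso_union (ltnW lt1d) cardC' dis sub cl.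
  (* Here [e] has no edge ([d = 0]) or a single one ([d = 1]), so [C] has [d.*2] vertices, and the
     extra vertex of $R(2d+1,d)$ is isolated. *)
  left; set C := non_isolated e.
  have clC x y : x \in C -> e x y -> y \in C.
    by move=> _ exy; rewrite inE; apply/existsP; exists x; rewrite sym.
  have degC x : x \in C -> deg e x = 1 /\ d = 1.
    rewrite inE => /existsP[y exy].
    have : 0 < deg e x by apply/card_gt0P; exists y; rewrite inE.
    by have := max_deg x; lia.
  have cardC : #|C| = d.*2.
    have : \sum_x deg e x = \sum_(x in C) 1.
      rewrite [RHS]big_mkcond; apply: eq_bigr => x _.
      case: ifP => [/degC[]//|]; rewrite inE => /negbT; rewrite negb_exists => /forallP no.
      by apply: eq_card0 => y; rewrite inE (negbTE (no y)).
    rewrite eqd sum1_card => <-; case: (d) led1 => [|[]] //.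
  have [f finj] : exists f : T -> 'I_(2 * d.+1 - 1), {in C &, injective f}.
    by apply: inj_in_ord; rewrite n1 ?cardC.
  exists (image_graph e C f); split; last split.
  + exact: image_graph_simple.
  + apply: image_graph_almost_regular => //.
      by move=> x /degC[-> ->]; left.
    rewrite cardC n1 (_ : [set x in C | _] = set0) ?cards0; first lia.
    by apply/setP=> x; rewrite inE in_set0; apply/andP=> -[/degC[-> ->]].
  + exact: image_graph_iso.
(* The degree sum is $(2d+1)d-c$ with $c\le 1$; being even by the handshake formula, it equals
   $2d^2+2\lfloor d/2\rfloor$. *)
- case=> [[r [[symr irrr] [reg iso]]]|[evk [r [[symr irrr] [reg iso]]]]].
    move: (iso_sum_deg sym symr iso) (handshake symr irrr).
    have [c c1] := sum_deg_almost_regular reg; rewrite card_ord.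
    move: (\sum_x deg r x) (nedges r) => X N; rewrite n1.
    move: (\sum_x deg e x) hs hg c1 => Y; clear; lia.
  have symu : symmetric (union_with_clique d r).
    by move=> [i|i] [j|j] //=; rewrite ?symr // eq_sym.
  move: (iso_sum_deg sym symu iso) (handshake symr irrr); rewrite sum_deg_union_clique.
  have [c c1] := sum_deg_almost_regular reg; rewrite card_ord.
  (* As $d$ is odd, parity forces $c=1$, and $(d+2)d-1+d(d-1)=2d^2+d-1$. *)
  move: (\sum_x deg r x) (nedges r) => X N.
  move: evk; rewrite /= negbK; move: (\sum_x deg e x) hs hg c1 => Y; clear.
  by case: d => // d; lia.
Qed.
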